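(* Balls in Bins admits an algorithm running in time $\mathcal{O}(2^s\cdot s^3\cdot t\cdot W^2)$, where $s$ is the number of balls, $t$ the number of bins and $W$ the budget.
   Context: Balls in Bins: the input consists of $s$ balls indexed $1,\dots,s$ with sizes $b_1,\dots,b_s\in\mathbb{N}$, $t$ bins indexed $1,\dots,t$ with capacities $x_1,\dots,x_t\in\mathbb{N}$, a budget $W\in\mathbb{N}$, and a cost function $\mathrm{cost}:[s]\times[t]\to\mathbb{N}\cup\{0\}$ ($\mathrm{cost}(i,j)$ is the cost of putting ball $i$ in bin $j$). An assignment is a function $\beta:[s]\to[t]$ such that for every $j\in[t]$, $\sum_{i\in\beta^{-1}(j)}b_i\le x_j$; its cost is $\sum_{i\in[s]}\mathrm{cost}(i,\beta(i))$. The question is whether an assignment of cost at most $W$ exists. *)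

(* Defs.v *)
From mathcomp Require Import all_boot.

Set Implicit Arguments.
Unset Strict Implicit.
Unset Printing Implicit Defensive.

(** * Unit-cost random access machine

    A program is a finite list of instructions acting on registers and on an
    addressable memory, both holding natural numbers.  The only arithmetic is
    addition and truncated subtraction: with unit-cost multiplication, T steps
    could produce numbers of 2^T bits. *)

Inductive instr : Type :=
| Const of nat & nat          (* Const r n      : r := n                 *)
| Add of nat & nat & nat      (* Add r r1 r2    : r := r1 + r2           *)
| Sub of nat & nat & nat      (* Sub r r1 r2    : r := r1 - r2           *)
| Read of nat & nat           (* Read r r1      : r := mem[r1]           *)
| Write of nat & nat          (* Write r1 r2    : mem[r1] := r2          *)
| Jump of nat                 (* Jump l         : goto l                 *)
| JumpZ of nat & nat          (* JumpZ r l      : if r = 0 then goto l   *)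
| Halt.

Definition program := seq instr.

Record config : Type := Config {
  pc : nat;
  reg : nat -> nat;
  mem : nat -> nat
}.

Definition upd (f : nat -> nat) (a v : nat) : nat -> nat :=
  fun x => if x == a then v else f x.

(* Running past the end of the program counts as halting. *)
Definition fetch (P : program) (c : config) : instr := nth Halt P (pc c).

Definition step (P : program) (c : config) : config :=
  let: Config p r m := c in
  match fetch P c with
  | Const d n   => Config p.+1 (upd r d n) m
  | Add d a b   => Config p.+1 (upd r d (r a + r b)) m
  | Sub d a b   => Config p.+1 (upd r d (r a - r b)) m
  | Read d a    => Config p.+1 (upd r d (m (r a))) m
  | Write a b   => Config p.+1 r (upd m (r a) (r b))
  | Jump l      => Config l r m
  | JumpZ a l   => Config (if r a == 0 then l else p.+1) r m
  | Halt        => c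
  end.

Definition halted (P : program) (c : config) : Prop := fetch P c = Halt.

Definition init (input : seq nat) : config :=
  Config 0 (fun=> 0) (nth 0 input).

(* The answer is read in register 0.  It does not depend on the choice of n,
   as [step] leaves halted configurations unchanged. *)
Definition outputs_within (P : program) (input : seq nat) (T : nat)
    (answer : bool) : Prop :=
  exists n : nat,
    [/\ n <= T,
        halted P (iter n (step P) (init input)) &
        reg (iter n (step P) (init input)) 0 = nat_of_bool answer].

(* All instances are subject to the bound, with one program and one constant. *)
Definition decidable_in_time_O (I : Type) (encode : I -> seq nat)
    (problem : I -> bool) (f : I -> nat) : Prop :=
  exists (P : program) (C : nat),
    forall x : I, outputs_within P (encode x) (C * f x) (problem x).

(** * Balls in Bins *)

(* Sizes, capacities and the budget are positive integers, whereas costs may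
   vanish. *)
Record balls_in_bins : Type := BallsInBins {
  nballs : nat;
  nbins : nat;
  size_of : 'I_nballs -> nat;
  capacity : 'I_nbins -> nat;
  budget : nat;
  cost : 'I_nballs -> 'I_nbins -> nat;
  nballs_gt0 : 0 < nballs;
  nbins_gt0 : 0 < nbins;
  size_of_gt0 : forall i, 0 < size_of i;
  capacity_gt0 : forall j, 0 < capacity j;
  budget_gt0 : 0 < budget
}.

Definition is_assignment (X : balls_in_bins)
    (beta : {ffun 'I_(nballs X) -> 'I_(nbins X)}) : bool :=
  [forall j, \sum_(i | beta i == j) size_of i <= capacity j].

Definition assignment_cost (X : balls_in_bins)
    (beta : {ffun 'I_(nballs X) -> 'I_(nbins X)}) : nat :=
  \sum_i cost i (beta i).

Definition has_cheap_assignment (X : balls_in_bins) : bool :=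
  [exists beta : {ffun 'I_(nballs X) -> 'I_(nbins X)},
     is_assignment beta && (assignment_cost beta <= budget X)].

(* Every number of the instance occupies one memory cell; costs are listed
   ball by ball. *)
Definition encode_instance (X : balls_in_bins) : seq nat :=
  [:: nballs X; nbins X; budget X]
  ++ [seq size_of i | i <- enum 'I_(nballs X)]
  ++ [seq capacity j | j <- enum 'I_(nbins X)]
  ++ [seq cost i j | i <- enum 'I_(nballs X), j <- enum 'I_(nbins X)].

(* Main.v *)
From mathcomp Require Import all_boot zify.
Require Import Defs.

Set Implicit Arguments.
Unset Strict Implicit.
Unset Printing Implicit Defensive.

(** Treat the bins one after the other, and for every set S of balls and every
    budget w <= W keep the largest capacity that can remain in the current bin
    when S is packed, at cost at most w, in the bins treated so far.  Nothing else
    about a packing matters for its extensions, so this maximum is obtained from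
    the packings of S minus a single ball i, to which i is added last in the
    current bin, and from the packings of S that leave the current bin empty.
    Hence no convolution over pairs of subsets is needed, and O(s) elementary
    steps per triple (bin, S, w) suffice: O(2^s * s * t * W) in total. *)

(** * Structured programs for the random access machine *)

Inductive cmd : Type :=
| Block of seq instr
| Seq of cmd & cmd
| IfNZ of nat & cmd
| While of nat & cmd.

Fixpoint code_size (c : cmd) : nat :=
  match c with
  | Block ops => size ops
  | Seq c1 c2 => code_size c1 + code_size c2
  | IfNZ _ c1 => (code_size c1).+1
  | While _ c1 => (code_size c1).+2
  end.

(** Jump targets are absolute, so the translation depends on the load address [l]. *)
Fixpoint compile (l : nat) (c : cmd) : program :=
  match c with
  | Block ops => ops
  | Seq c1 c2 => compile l c1 ++ compile (l + code_size c1) c2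
  | IfNZ x c1 => JumpZ x (l + (code_size c1).+1) :: compile l.+1 c1
  | While x c1 =>
      JumpZ x (l + (code_size c1).+2) :: rcons (compile l.+1 c1) (Jump l)
  end.

Lemma size_compile l c : size (compile l c) = code_size c.
Proof.
elim: c l => [ops|c1 IH1 c2 IH2|x c1 IH|x c1 IH] l //=.
- by rewrite size_cat IH1 IH2.
- by rewrite IH.
- by rewrite size_rcons IH.
Qed.

Definition code_at (P : program) (l : nat) (code : program) : Prop :=
  forall i, i < size code -> nth Halt P (l + i) = nth Halt code i.

Lemma code_at_cat P l s1 s2 :
  code_at P l (s1 ++ s2) -> code_at P l s1 /\ code_at P (l + size s1) s2.
Proof.
move=> H; split=> i Hi.
  by rewrite H ?nth_cat ?Hi // size_cat ltn_addr.
rewrite -addnA H ?size_cat ?ltn_add2l // nth_cat ifF; last by lia.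
by congr nth; lia.
Qed.

Lemma code_at_cons P l x s1 :
  code_at P l (x :: s1) -> nth Halt P l = x /\ code_at P l.+1 s1.
Proof.
move=> H; split; first by have /= := H 0 isT; rewrite addn0.
by move=> i Hi; have /= := H i.+1 Hi; rewrite addnS.
Qed.

Definition state_pred := (nat -> nat) -> (nat -> nat) -> Prop.

(* Started in (r, m), the code of [c] reaches its end within T steps, in a state
   satisfying Q, wherever it is loaded. *)
Definition wp (c : cmd) (r m : nat -> nat) (T : nat) (Q : state_pred) : Prop :=
  forall P l, code_at P l (compile l c) ->
  exists n r' m',
    [/\ n <= T,
        iter n (step P) (Config l r m) = Config (l + code_size c) r' m' &
        Q r' m'].

Lemma wp_weaken c r m T T' (Q Q' : state_pred) :
  wp c r m T Q -> T <= T' -> (forall r m, Q r m -> Q' r m) -> wp c r m T' Q'.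
Proof.
move=> H le_T QQ' P l /H [n [r' [m' [le_n E q]]]].
by exists n, r', m'; split; [exact: leq_trans le_T| |exact: QQ'].
Qed.

(** Weakest precondition by symbolic execution; [False] on jumps and [Halt] confines blocks to
    straight-line code. *)
Fixpoint block_post (ops : seq instr) (r m : nat -> nat) (Q : state_pred) :=
  match ops with
  | [::] => Q r m
  | Const d n :: ops' => block_post ops' (upd r d n) m Q
  | Add d a b :: ops' => block_post ops' (upd r d (r a + r b)) m Q
  | Sub d a b :: ops' => block_post ops' (upd r d (r a - r b)) m Q
  | Read d a :: ops' => block_post ops' (upd r d (m (r a))) m Q
  | Write a b :: ops' => block_post ops' r (upd m (r a) (r b)) Q
  | _ => False
  end.

Lemma wp_block ops r m Q :
  block_post ops r m Q -> wp (Block ops) r m (size ops) Q.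
Proof.
move=> H P l /=; elim: ops r m l H => [|o ops IH] r m l /= H.
  by move=> _; exists 0, r, m; rewrite addn0.
case/code_at_cons=> Eo /(IH _ _ _ _) {}IH.
case: o H Eo => //= [d n|d a b|d a b|d a|a b] /IH [k [r' [m' [le_k E q]]]] Eo;
  by exists k.+1, r', m'; split=> //; rewrite iterSr addnS -addSn -E /= /fetch /= Eo.
Qed.

Lemma wp_seq c1 c2 r m T1 T2 Q :
  wp c1 r m T1 (fun r' m' => wp c2 r' m' T2 Q) ->
  wp (Seq c1 c2) r m (T1 + T2) Q.
Proof.
move=> H P l /= /code_at_cat []; rewrite size_compile.
move=> /H [n1 [r1 [m1 [le1 E1 H1]]]] /H1 [n2 [r2 [m2 [le2 E2 q]]]].
exists (n2 + n1), r2, m2; split=> //; first by rewrite addnC leq_add.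
by rewrite iterD E1 E2 addnA.
Qed.

Lemma wp_seq_mid c1 c2 r m T1 T2 (Q1 Q : state_pred) :
  wp c1 r m T1 Q1 -> (forall r m, Q1 r m -> wp c2 r m T2 Q) ->
  wp (Seq c1 c2) r m (T1 + T2) Q.
Proof. by move=> H1 H2; apply: wp_seq; apply: wp_weaken H1 _ H2. Qed.

Lemma wp_ifnz x c r m T Q :
  (r x = 0 -> Q r m) -> (r x <> 0 -> wp c r m T Q) -> wp (IfNZ x c) r m T.+1 Q.
Proof.
move=> H0 H1 P l /= /code_at_cons [Ex Hc].
have [/eqP rx0|/eqP rx0] := boolP (r x == 0).
  by exists 1, r, m; split=> //=; [rewrite /fetch /= Ex /= rx0|exact: H0].
have [n [r' [m' [le_n E q]]]] := H1 rx0 _ _ Hc.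
exists n.+1, r', m'; split=> //.
rewrite iterSr addnS -addSn -E /= /fetch /= Ex.
by rewrite (negbTE (introN eqP rx0)).
Qed.

(** The index of [I] is the exact number of iterations still to come. Each costs its body plus the
    test and the jump back, and the last test adds one step. *)
Lemma wp_while x c r m n T (I : nat -> state_pred) (Q : state_pred) :
  I n r m ->
  (forall k r m, k < n -> I k.+1 r m -> r x <> 0 /\ wp c r m T (I k)) ->
  (forall r m, I 0 r m -> r x = 0 /\ Q r m) ->
  wp (While x c) r m (n * T.+2).+1 Q.
Proof.
move=> In Istep I0 P l /= /code_at_cons [Ex].
rewrite -cats1 => /code_at_cat []; rewrite size_compile => Hc.
case/code_at_cons=> Ej _.
elim: n r m In Istep => [|n IH] r m In Istep.
  have [rx0 q] := I0 _ _ In.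
  by exists 1, r, m; split=> //=; rewrite /fetch /= Ex rx0.
have [rx0 /(_ _ _ Hc) [n1 [r1 [m1 [le1 E1 H1]]]]] := Istep n _ _ (leqnn _) In.
have [k r' m' lt_k|n2 [r2 [m2 [le2 E2 q]]]] := IH _ _ H1.
  by apply: Istep; apply: ltnW.
exists (n2 + (n1.+1).+1), r2, m2; split=> //; first by lia.
rewrite iterD iterS iterSr [step P (Config l r m)]/= /fetch /= Ex.
rewrite (negbTE (introN eqP rx0)) E1.
suff -> : step P (Config (l.+1 + code_size c) r1 m1) = Config l r1 m1 by [].
by rewrite /step /fetch /= Ej.
Qed.

(** * Subsets encoded as bit masks *)

Definition bit (S i : nat) : bool := odd (S %/ 2 ^ i).

Lemma bit0 i : bit 0 i = false.
Proof. by rewrite /bit div0n. Qed.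

Lemma mod_exp2S S i : S %% 2 ^ i.+1 = bit S i * 2 ^ i + S %% 2 ^ i.
Proof.
have e_gt0 : 0 < 2 ^ i by rewrite expn_gt0.
rewrite {1}(divn_eq S (2 ^ i)) {1}(divn_eq (S %/ 2 ^ i) 2) modn2.
rewrite mulnDl -mulnA -expnS -addnA modnMDl modn_small // expnS.
have := ltn_pmod S e_gt0; rewrite /bit; case: odd; lia.
Qed.

Lemma bitE S i : bit S i = (2 ^ i <= S %% 2 ^ i.+1).
Proof.
have := @ltn_pmod S (2 ^ i); rewrite expn_gt0 => /(_ isT).
rewrite mod_exp2S; case: bit; lia.
Qed.

Lemma bit_le S i : bit S i -> 2 ^ i <= S.
Proof. by rewrite bitE => /leq_trans; apply; apply: leq_mod. Qed.

Lemma bits_eq0 n S : S < 2 ^ n -> (forall i, i < n -> ~~ bit S i) -> S = 0.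
Proof.
move=> ltS H; rewrite -(modn_small ltS).
elim: n {ltS} H => [|n IH] H; first by rewrite modn1.
rewrite mod_exp2S (negbTE (H n _)) // IH // => i lti; exact/H/ltnW.
Qed.

Lemma bit_full n i : i < n -> bit (2 ^ n - 1) i.
Proof.
move=> lt_in; have e_gt0 k : 0 < 2 ^ k by rewrite expn_gt0.
(* This displays the quotient of [2 ^ n - 1] by [2 ^ i], which is visibly odd, and a remainder below
   [2 ^ i]. *)
suff -> : 2 ^ n - 1 = (2 ^ (n - i.+1) * 2 - 1) * 2 ^ i + (2 ^ i - 1).
  rewrite /bit divnMDl // [_ %/ _]divn_small ?addn0; last by have := e_gt0 i; lia.
  have := e_gt0 (n - i.+1); rewrite oddB; last by lia.
  by rewrite oddM andbF.
have -> : 2 ^ n = 2 ^ (n - i.+1) * 2 * 2 ^ i.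
  by rewrite -mulnA -expnS -expnD subnK.
have := e_gt0 (n - i.+1); have := e_gt0 i; nia.
Qed.

(** Since bit i is set, the subtraction produces no borrow: it removes i from the set and leaves
    every other element. *)
Lemma bit_subn S i k : bit S i -> bit (S - 2 ^ i) k = bit S k && (k != i).
Proof.
move=> bi; have := subnK (bit_le bi); move: (S - _) => S' ES.
have e_gt0 l : 0 < 2 ^ l by rewrite expn_gt0.
move: bi; rewrite -ES /bit {ES}.
have Ei : (S' + 2 ^ i) %/ 2 ^ i = (S' %/ 2 ^ i).+1 by rewrite divnDr ?divnn ?e_gt0 ?addn1.
rewrite Ei /= => odd'; case: ltngtP => [lt_ki|lt_ik|->]; rewrite ?andbT ?andbF.
- have -> : 2 ^ i = 2 ^ k * 2 * 2 ^ (i - k.+1).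
    by rewrite [_ * 2]mulnC -expnS -expnD subnKC.
  by rewrite -mulnA divnDr ?dvdn_mulr // mulKn // oddD oddM addbF.
- have -> : 2 ^ k = 2 ^ i * 2 * 2 ^ (k - i.+1).
    by rewrite [_ * 2]mulnC -expnS -expnD subnKC.
  by rewrite !divnMA Ei !divn2 -uphalfE uphalf_half (negbTE odd').
- by rewrite (negbTE odd').
Qed.

(** * The dynamic program *)

Section DynamicProgram.

Variables (s : nat) (b x : nat -> nat) (c : nat -> nat -> nat).

Definition load (S : nat) (f : nat -> nat) (j : nat) : nat :=
  \sum_(0 <= i < s | bit S i && (f i == j)) b i.

Definition total_cost (S : nat) (f : nat -> nat) : nat :=
  \sum_(0 <= i < s | bit S i) c i (f i).

(** A packing of S is a total function whose values outside S are irrelevant, so the same f can be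
    reused for subsets of S. *)
Definition feasible (j S w : nat) (f : nat -> nat) : Prop :=
  [/\ forall i, i < s -> bit S i -> f i < j,
      forall k, k < j -> load S f k <= x k &
      total_cost S f <= w].

(* The dynamic program stores in the cell of (S, w), for the current bin j, one
   plus the largest capacity that can be left over in bin j when the balls of S
   go to bins 0, ..., j at total cost at most w, and 0 if that is impossible.
   Before bin j is treated, the cell only has to tell whether bins 0, ..., j-1
   suffice. *)
Definition cell_decides (j S w v : nat) : Prop :=
  0 < v <-> exists f, feasible j S w f.

Definition cell_sound (j S w v : nat) : Prop :=
  0 < v -> exists f, feasible j.+1 S w f /\ load S f j + v <= (x j).+1.

Definition cell_optimal (j S w v : nat) : Prop :=
  cell_sound j S w v /\
  forall f, feasible j.+1 S w f -> x j < load S f j + v.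

(** Passes from a finished bin to the next one: a packing loads bin j by at most [x j], so
    optimality forces v to be positive. *)
Lemma cell_optimal_decides j S w v : cell_optimal j S w v -> cell_decides j.+1 S w v.
Proof.
move=> [Hs Hc]; split=> [/Hs [f [Hf _]]|[f Hf]]; first by exists f.
by have := Hc f Hf; case: Hf => _ /(_ j (leqnn _)); lia.
Qed.

(** Without bins no nonempty set can be packed, so zeroed memory is already the correct initial
    table. *)
Lemma cell_decides0 S w : 0 < S -> S < 2 ^ s -> cell_decides 0 S w 0.
Proof.
move=> S_gt0 ltS; split=> // -[f [Hf _ _]].
suff S0 : S = 0 by rewrite S0 in S_gt0.
by apply: (bits_eq0 ltS) => i lti; apply/negP => /(Hf i lti).
Qed.

Lemma load_bit S f j i : i < s -> bit S i ->
  load S f j = (f i == j) * b i + load (S - 2 ^ i) f j.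
Proof.
move=> lti bi; rewrite /load !big_mkord.
pose i' := Ordinal lti; rewrite big_mkcond (bigD1 i') //= bi /=.
rewrite [in RHS]big_mkcond [in RHS](bigD1 i') //= bit_subn // eqxx andbF add0n.
congr (_ + _); first by case: eqP; rewrite ?mul1n.
apply: eq_bigr => k neq_k; rewrite bit_subn //.
by have -> : (k != i :> nat) = (k != i'); rewrite ?neq_k ?andbT.
Qed.

Lemma total_cost_bit S f i : i < s -> bit S i ->
  total_cost S f = c i (f i) + total_cost (S - 2 ^ i) f.
Proof.
move=> lti bi; rewrite /total_cost !big_mkord.
pose i' := Ordinal lti; rewrite big_mkcond (bigD1 i') //= bi /=.
rewrite [in RHS]big_mkcond [in RHS](bigD1 i') //= bit_subn // eqxx andbF add0n.
congr (_ + _).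
apply: eq_bigr => k neq_k; rewrite bit_subn //.
by have -> : (k != i :> nat) = (k != i'); rewrite ?neq_k ?andbT.
Qed.

Lemma eq_load S f g j : (forall i, i < s -> bit S i -> f i = g i) ->
  load S f j = load S g j.
Proof.
move=> fg; rewrite /load !big_mkord; apply: eq_bigl => i.
by case bi: bit; rewrite //= fg.
Qed.

Lemma eq_total_cost S f g : (forall i, i < s -> bit S i -> f i = g i) ->
  total_cost S f = total_cost S g.
Proof.
by move=> fg; rewrite /total_cost !big_mkord; apply: eq_bigr => i bi; rewrite fg.
Qed.

Lemma load_notin S f j :
  (forall i, i < s -> bit S i -> f i <> j) -> load S f j = 0.
Proof.
move=> H; rewrite /load big_mkord big1 // => i /andP [bi /eqP fi].
by case: (H i).
Qed.

(** The choice of leaving bin j empty: its whole capacity remains, stored as [(x j).+1]. *)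
Lemma cell_sound_init j S w v :
  (0 < S -> cell_decides j S w v) -> (S = 0 \/ 0 < v) -> cell_sound j S w (x j).+1.
Proof.
move=> Hw SV _; have [S0|S_gt0] := posnP S.
  have nobit i : bit S i = false by rewrite S0 bit0.
  have l0 k : load S id k = 0 by rewrite load_notin // => i _; rewrite nobit.
  (* Any function packs the empty set; [id] is an arbitrary choice. *)
  exists id; rewrite l0; split=> //; split=> [i|k|]; rewrite ?nobit ?l0 //.
  by rewrite /total_cost big1_seq // => i; rewrite nobit.
have [f [Hf Hl Hc]] : exists f, feasible j S w f.
  by apply: (Hw S_gt0).1; case: SV => // S0; rewrite S0 in S_gt0.
have E : load S f j = 0 by apply: load_notin => i lti /(Hf i lti); lia.
exists f; rewrite E; split=> //.
split=> // [i lti /(Hf i lti)|k]; first exact: ltnW.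
by rewrite ltnS leq_eqVlt => /orP [/eqP ->|/Hl //]; rewrite E.
Qed.

(** The packing behind u is redirected at i to bin j. A positive [u - b i] says exactly that ball i
    fits into the room that is left. *)
Lemma cell_sound_add j S w i u : i < s -> bit S i -> c i j <= w ->
  cell_sound j (S - 2 ^ i) (w - c i j) u -> cell_sound j S w (u - b i).
Proof.
move=> lti bi le_cw Hu v_gt0.
have [|f [[Hf Hl Hc] Hv]] := Hu; first by lia.
pose g := upd f i j; exists g.
have gf : forall k, k < s -> bit (S - 2 ^ i) k -> g k = f k.
  by move=> k _; rewrite bit_subn // /g /upd => /andP [_ /negbTE ->].
have gi : g i = j by rewrite /g /upd eqxx.
have E k : load S g k = (j == k) * b i + load (S - 2 ^ i) f k.
  by rewrite (load_bit _ _ lti bi) gi (eq_load _ gf).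
have Ej : load S g j = b i + load (S - 2 ^ i) f j by rewrite E eqxx mul1n.
split; last by rewrite Ej; lia.
split=> [k ltk bk|k ltk|].
- have [->|neq_k] := eqVneq k i; first by rewrite gi.
  by rewrite gf // ?bit_subn ?bk //; apply: Hf; rewrite // bit_subn // bk.
- have [<-|neq_k] := eqVneq j k; first by rewrite Ej; lia.
  by rewrite E (negbTE neq_k); apply: Hl.
- by rewrite (total_cost_bit _ lti bi) gi (eq_total_cost gf); lia.
Qed.

Lemma cell_sound_max j S w u v :
  cell_sound j S w u -> cell_sound j S w v -> cell_sound j S w (v + (u - v)).
Proof.
move=> Hu Hv; have [le_uv|lt_vu] := leqP u v.
  by move: le_uv; rewrite -subn_eq0 => /eqP ->; rewrite addn0.
by rewrite subnKC // ltnW.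
Qed.

(** Optimality of the recurrence. If f puts some ball i into bin j, then f also packs [S - 2 ^ i]
    within budget [w - c i j], and optimality of [u i] bounds the room left by f. Otherwise f uses
    only earlier bins, and the starting value [(x j).+1] already suffices. *)
Lemma cell_optimal_max j S w v v0 (u : nat -> nat) :
  (0 < S -> cell_decides j S w v0) -> (S = 0 \/ 0 < v0 -> x j < v) ->
  cell_sound j S w v ->
  (forall i, i < s -> bit S i -> c i j <= w ->
     cell_optimal j (S - 2 ^ i) (w - c i j) (u i)) ->
  (forall i, i < s -> bit S i -> c i j <= w -> u i - b i <= v) ->
  cell_optimal j S w v.
Proof.
move=> Hw Hv0 Hs Hu Hv; split=> // f [Hf Hl Hc].
have [/hasP [i]|/hasPn H] := boolP (has (fun i => bit S i && (f i == j)) (iota 0 s)).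
  rewrite mem_iota => lti /andP [bi /eqP fi].
  have lti' : i < s by lia.
  have Ec := total_cost_bit f lti' bi.
  have El := load_bit f _ lti' bi.
  have le_cw : c i j <= w by rewrite fi in Ec; lia.
  have [_ /(_ f)] := Hu i lti' bi le_cw.
  have := Hv i lti' bi le_cw.
  have Elj := El j; rewrite fi eqxx mul1n in Elj.
  move=> le_v lt_x; suff /lt_x : feasible j.+1 (S - 2 ^ i) (w - c i j) f.
    by rewrite Elj; lia.
  split=> [k ltk|k ltk|].
  - by rewrite bit_subn // => /andP [bk _]; apply: Hf.
  - by have := Hl k ltk; rewrite El; lia.
  - by rewrite Ec fi in Hc; lia.
have fj : forall i, i < s -> bit S i -> f i < j.
  move=> i lti bi; have := Hf i lti bi; rewrite ltnS leq_eqVlt => /orP [/eqP E|//].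
  by have := H i; rewrite mem_iota bi E eqxx /= => /(_ lti).
rewrite ltn_addl // Hv0 //.
have [|S_gt0] := posnP S; [by left|right].
apply/(Hw S_gt0); exists f; split=> // k ltk; apply: Hl; exact: ltnW.
Qed.

End DynamicProgram.

(** * The random access machine program *)

Local Notation r_out := 0 (only parsing).
Local Notation r_one := 1 (only parsing).
Local Notation r_s := 2 (only parsing).
Local Notation r_t := 3 (only parsing).
Local Notation r_width := 4 (only parsing).
Local Notation r_pow := 5 (only parsing).
Local Notation r_base := 6 (only parsing).
Local Notation r_st := 7 (only parsing).
Local Notation r_total := 8 (only parsing).
Local Notation r_three := 9 (only parsing).
Local Notation r_cap := 10 (only parsing).
Local Notation r_capptr := 11 (only parsing).
Local Notation r_binctr := 12 (only parsing).
Local Notation r_cell := 13 (only parsing).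
Local Notation r_set := 14 (only parsing).
Local Notation r_setctr := 15 (only parsing).
Local Notation r_bud := 16 (only parsing).
Local Notation r_budctr := 17 (only parsing).
Local Notation r_v := 18 (only parsing).
Local Notation r_k := 19 (only parsing).
Local Notation r_costptr := 20 (only parsing).
Local Notation r_rem := 21 (only parsing).
Local Notation r_p := 22 (only parsing).
Local Notation r_d := 23 (only parsing).
Local Notation r_c := 24 (only parsing).
Local Notation r_u := 25 (only parsing).
Local Notation r_tmp := 26 (only parsing).

(* The input occupies the cells below [pow_base]; the table of the numbers
   2 ^ i * W.+1 follows, and the dynamic programming table starts at [base], the
   cell of (S, w) being base + (S * W.+1 + w).  Subsets are always handled as
   S * W.+1, so that the same entry 2 ^ i * W.+1 serves to test the bit i and to
   reach the row of S - 2 ^ i.  [r_bud] holds w + 1, which turns the test c <= w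
   into a nonzero test; v + (u - v) is the maximum of u and v, and the truncated
   subtraction of the size maps an exceeded capacity to 0, i.e. infeasible. *)
Definition try_ball : cmd :=
  Block [:: Sub r_d r_cell r_p; Sub r_d r_d r_c; Read r_u r_d;
            Add r_tmp r_three r_k; Read r_tmp r_tmp;
            Sub r_u r_u r_tmp; Sub r_u r_u r_v; Add r_v r_v r_u].

Definition ball_body : cmd :=
  Seq (Block [:: Sub r_k r_k r_one; Read r_c r_costptr;
                 Sub r_costptr r_costptr r_t;
                 Add r_tmp r_pow r_k; Read r_p r_tmp;
                 Add r_d r_rem r_one; Sub r_d r_d r_p])
      (IfNZ r_d
        (Seq (Block [:: Sub r_rem r_rem r_p; Sub r_d r_bud r_c])
             (IfNZ r_d try_ball))).

(** The first test computes (1 - set) + v, which is nonzero iff S is empty or the earlier bins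
    suffice; v then starts at [(x j).+1]. Adding a register known to be 0 serves as a copy
    instruction. *)
Definition cell_body : cmd :=
  Seq (Block [:: Read r_v r_cell; Sub r_d r_one r_set; Add r_d r_d r_v])
  (Seq (IfNZ r_d (Block [:: Const r_d 0; Add r_v r_cap r_d]))
  (Seq (Block [:: Const r_d 0; Add r_k r_s r_d;
                  Add r_costptr r_capptr r_st; Add r_rem r_set r_d])
  (Seq (While r_k ball_body)
       (Block [:: Write r_cell r_v; Add r_cell r_cell r_one;
                  Add r_bud r_bud r_one; Sub r_budctr r_budctr r_one])))).

Definition set_body : cmd :=
  Seq (Block [:: Const r_bud 1; Const r_d 0; Add r_budctr r_width r_d])
  (Seq (While r_budctr cell_body)
       (Block [:: Add r_set r_set r_width;
                  Sub r_setctr r_setctr r_width])).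

Definition bin_body : cmd :=
  Seq (Block [:: Read r_cap r_capptr; Add r_cap r_cap r_one; Const r_set 0;
                 Add r_cell r_base r_set; Add r_setctr r_total r_set])
  (Seq (While r_setctr set_body)
       (Block [:: Add r_capptr r_capptr r_one;
                  Sub r_binctr r_binctr r_one])).

Definition setup : cmd :=
  Seq (Block [:: Read r_s r_out; Const r_one 1; Read r_t r_one;
                 Const r_d 2; Read r_width r_d; Add r_width r_width r_one;
                 Const r_three 3; Add r_k r_s r_st])
  (Seq (While r_k (Block [:: Add r_st r_st r_t; Sub r_k r_k r_one]))
  (Seq (Block [:: Add r_capptr r_three r_s; Add r_pow r_capptr r_t;
                  Add r_pow r_pow r_st; Add r_k r_s r_out;
                  Add r_total r_width r_out; Add r_base r_pow r_out])
  (Seq (While r_k (Block [:: Write r_base r_total; Add r_total r_total r_total;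
                             Add r_base r_base r_one; Sub r_k r_k r_one]))
       (Block [:: Add r_binctr r_t r_out])))).

(** After the last bin [r_cell] is one past the table, so its predecessor is the cell of the full
    set with budget W. The final subtractions compute 1 - (1 - v), the truth value of 0 < v. *)
Definition solver : cmd :=
  Seq setup
  (Seq (While r_binctr bin_body)
       (Block [:: Sub r_cell r_cell r_one; Read r_v r_cell;
                  Sub r_v r_one r_v; Sub r_out r_one r_v])).

(** With p = 2 ^ k, [e * p + q] is the remainder of S modulo 2 ^ k.+1 and e is bit k; adding 1
    before subtracting turns the comparison into a nonzero test. *)
Lemma bit_test (e : bool) p q n : q < p ->
  ((e * p + q) * n.+1 + 1 - p * n.+1 == 0) = ~~ e.
Proof.
move=> lt_qp; have := leq_mul lt_qp (leqnn n.+1).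
by rewrite mulnDl !mulSn; case: e; rewrite ?mul1n ?mul0n /=; lia.
Qed.

Lemma pred_cell_addr a S p n w d : p <= S -> d <= w ->
  a + (S * n + w) - p * n - d = a + ((S - p) * n + (w - d)).
Proof.
move=> le_p le_d; have := leq_mul le_p (leqnn n).
by rewrite mulnBl; lia.
Qed.

(** The recurrence reads only earlier rows, so a single table can be updated in place in increasing
    order. *)
Lemma pred_cell_lt S p n w d : 0 < p -> p <= S ->
  (S - p) * n.+1 + (w - d) < S * n.+1 + w.
Proof.
move=> p_gt0 le_p; have := leq_mul le_p (leqnn n.+1).
by have := leq_mul p_gt0 (leqnn n.+1); rewrite mulnBl mul1n; lia.
Qed.

Lemma cell_inj n S w S' w' : w < n -> w' < n ->
  S * n + w = S' * n + w' -> S = S' /\ w = w'.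
Proof.
move=> ltw ltw' E.
have ES : S = S'.
  have n_gt0 : 0 < n by apply: leq_ltn_trans ltw.
  have := congr1 (fun q => q %/ n) E.
  by rewrite !divnMDl // !divn_small // !addn0.
by split=> //; move: E; rewrite ES => /addnI.
Qed.

(** * Correctness and step counts of the program, from the innermost loop outwards *)

Section Correctness.

Variables (s t W : nat) (inp : nat -> nat).
Hypotheses (s_gt0 : 0 < s) (t_gt0 : 0 < t).
Hypotheses (inp0 : inp 0 = s) (inp1 : inp 1 = t) (inp2 : inp 2 = W).
Hypothesis inp_out : forall a, 3 + s + t + s * t <= a -> inp a = 0.

Let b i := inp (3 + i).
Let x j := inp (3 + s + j).
Let c i j := inp (3 + s + t + (i * t + j)).
Let pow_base := 3 + s + t + s * t.
Let base := pow_base + s.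

Local Notation cell_sound := (cell_sound s b x c).
Local Notation cell_decides := (cell_decides s b x c).
Local Notation cell_optimal := (cell_optimal s b x c).

Definition consts (r : nat -> nat) : Prop :=
  [/\ r r_one = 1, r r_s = s, r r_t = t, r r_width = W.+1 & r r_pow = pow_base]
  /\ [/\ r r_base = base, r r_st = s * t, r r_total = 2 ^ s * W.+1 &
        r r_three = 3].

Definition layout (m : nat -> nat) : Prop :=
  (forall a, a < pow_base -> m a = inp a) /\
  (forall i, i < s -> m (pow_base + i) = 2 ^ i * W.+1).

(* The cells below [q] are already updated for bin j. The rows of the empty set
   need no initialisation, since [cell_body] treats S = 0 as feasible. *)
Definition table (j q : nat) (m : nat -> nat) : Prop :=
  forall S w, S < 2 ^ s -> w < W.+1 ->
  if S * W.+1 + w < q then cell_optimal j S w (m (base + (S * W.+1 + w)))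
  else 0 < S -> cell_decides j S w (m (base + (S * W.+1 + w))).

Definition bin_regs (j : nat) (r : nat -> nat) : Prop :=
  [/\ consts r, r r_cap = (x j).+1, r r_capptr = 3 + s + j & r r_binctr = t - j].

Definition cell_regs (j S w : nat) (r : nat -> nat) : Prop :=
  [/\ bin_regs j r, r r_cell = base + (S * W.+1 + w), r r_set = S * W.+1,
      r r_setctr = (2 ^ s - S) * W.+1 & r r_bud = w.+1
      /\ r r_budctr = W.+1 - w].

(* Balls are scanned downwards, so that the remainder of S modulo 2 ^ k reveals
   the bit k - 1. [v0] is the value of the cell before bin j. *)
Definition scan_inv (j S w v0 : nat) (m0 : nat -> nat) (k : nat) : state_pred :=
  fun r m =>
  [/\ cell_regs j S w r, m = m0,
      [/\ r r_k = k, r r_costptr = 3 + s + j + k * t &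
          r r_rem = S %% 2 ^ k * W.+1] &
      [/\ S = 0 \/ 0 < v0 -> x j < r r_v, cell_sound j S w (r r_v) &
       forall i, k <= i -> i < s -> bit S i -> c i j <= w ->
         m0 (base + ((S - 2 ^ i) * W.+1 + (w - c i j))) - b i <= r r_v]].

Lemma layout_cost m i j :
  layout m -> i < s -> j < t -> m (3 + s + t + (i * t + j)) = c i j.
Proof. by move=> [lay _] lti ltj; rewrite lay // /pow_base; nia. Qed.

Lemma layout_size m i : layout m -> i < s -> m (3 + i) = b i.
Proof. by move=> [lay _] lti; rewrite lay // /pow_base; lia. Qed.

Lemma layout_capacity m j : layout m -> j < t -> m (3 + s + j) = x j.
Proof. by move=> [lay _] ltj; rewrite lay // /pow_base; lia. Qed.

Lemma ball_body_spec j S w v0 m k r m' :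
  j < t -> S < 2 ^ s -> w < W.+1 -> k < s -> layout m ->
  table j (S * W.+1 + w) m ->
  scan_inv j S w v0 m k.+1 r m' ->
  wp ball_body r m' 19 (scan_inv j S w v0 m k).
Proof.
move=> ltj ltS ltw ltk lay tab.
case=> Hregs -> [Ek Ecp Er] [Hv0 Hs Hm].
have := Hregs; case=> -[[[E1 E2 E3 E4 E5] [E6 E7 E8 E9]] _ _ _] E13 _ _ [E16 _].
have EP : m (r 5 + (r 19 - r 1)) = 2 ^ k * W.+1.
  by rewrite E5 Ek E1 subn1 /=; case: lay => _ ->.
(* The cost pointer 3 + s + j + k.+1 * t is already the address of the cost of ball k, as 3 + s + t
   + (k * t + j). *)
have EC : m (r 20) = c k j.
  by rewrite Ecp -(layout_cost lay) //; congr m; lia.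
have EK : r 19 - r 1 = k by lia.
have ECP : r 20 - r 3 = 3 + s + j + k * t by lia.
have EM := mod_exp2S S k.
have ltM : S %% 2 ^ k < 2 ^ k by rewrite ltn_mod expn_gt0.
apply: (wp_seq (T1 := 7) (T2 := 12)); apply: wp_block.
rewrite /= /upd /= EP EC EK ECP E1; apply: wp_ifnz; rewrite /= Er EM => /eqP.
all: rewrite bit_test // ?negbK => D0.
  have nb := negbTE D0.
  split; [exact: Hregs|by []| |].
    by split; rewrite /= ?Er ?EM ?nb.
  split=> //= i; rewrite leq_eqVlt => /orP [/eqP <-|]; last exact: Hm.
  by rewrite nb.
move: D0 => bk.
have ER : r 21 - 2 ^ k * W.+1 = S %% 2 ^ k * W.+1 by rewrite Er EM bk mul1n mulnDl addKn.
apply: (wp_seq (T1 := 2) (T2 := 9)); apply: wp_block.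
rewrite /= /upd /= ER E16; apply: wp_ifnz => /= /eqP; rewrite subn_eq0 => D1.
  split; [exact: Hregs|by []|by []|].
  split=> //= i; rewrite leq_eqVlt => /orP [/eqP <-|]; last exact: Hm.
  by move=> _ _; rewrite leqNgt D1.
have lecw : c k j <= w by rewrite leqNgt.
have leS := bit_le bk.
have Ed : r 13 - 2 ^ k * W.+1 - c k j = base + ((S - 2 ^ k) * W.+1 + (w - c k j)).
  by rewrite E13 pred_cell_addr.
apply: (wp_block (ops := [:: _; _; _; _; _; _; _; _])).
rewrite /= /upd /= Ed E9 (layout_size lay ltk).
set u := m (base + ((S - 2 ^ k) * W.+1 + (w - c k j))).
(* This cell lies below the current one, so the table invariant says that it is already updated for
   bin j. *)
have Hu : cell_sound j (S - 2 ^ k) (w - c k j) u.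
  have := @tab (S - 2 ^ k) (w - c k j).
  rewrite pred_cell_lt ?expn_gt0 //; case=> //.
    exact: leq_ltn_trans (leq_subr _ _) ltS.
  exact: leq_ltn_trans (leq_subr _ _) ltw.
split; [exact: Hregs|by []|by []|].
split=> /=.
- by move=> /Hv0 /leq_trans; apply; apply: leq_addr.
- by apply: cell_sound_max => //; apply: cell_sound_add.
- move=> i; rewrite leq_eqVlt => /orP [/eqP <- _ _ _|lt_ki lti bi lec].
    by rewrite -/u -leq_subLR.
  exact: leq_trans (Hm i lt_ki lti bi lec) (leq_addr _ _).
Qed.

(** Moving the frontier by one changes the requirement on the written cell only, and [cell_inj]
    makes its pair (S, w) unique. *)
Lemma table_write j S w m v : w < W.+1 ->
  table j (S * W.+1 + w) m -> cell_optimal j S w v ->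
  table j (S * W.+1 + w.+1) (upd m (base + (S * W.+1 + w)) v).
Proof.
move=> ltw tab Hv S' w' ltS' ltw'.
rewrite addnS ltnS leq_eqVlt /upd eqn_add2l; have := tab S' w' ltS' ltw'.
have [E|neq] := eqVneq; last by [].
by have [-> ->] := cell_inj ltw' ltw E.
Qed.

Lemma layout_write m a v : base <= a -> layout m -> layout (upd m a v).
Proof.
rewrite /base => le_a [lay_in lay_pow]; split=> [a' lt_a|i lti]; rewrite /upd.
  by rewrite ifN ?lay_in //; apply/eqP; lia.
by rewrite ifN ?lay_pow //; apply/eqP; lia.
Qed.

Definition cell_inv (j S w : nat) : state_pred := fun r m =>
  [/\ cell_regs j S w r, layout m & table j (S * W.+1 + w) m].

Lemma cell_body_spec j S w r m :
  j < t -> S < 2 ^ s -> w < W.+1 -> cell_inv j S w r m ->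
  wp cell_body r m (s * 21 + 15) (cell_inv j S w.+1).
Proof.
move=> ltj ltS ltw [Hregs lay tab].
have := Hregs; case=> -[[[E1 E2 E3 E4 E5] [E6 E7 E8 E9]] E10 E11 E12].
move=> E13 E14 E15 [E16 E17].
set v0 := m (base + (S * W.+1 + w)).
have Hv0 : 0 < S -> cell_decides j S w v0.
  by have := tab S w ltS ltw; rewrite ltnn.
have -> : s * 21 + 15 = 3 + (3 + (4 + ((s * 21).+1 + 4))) by lia.
apply: wp_seq; apply: (wp_block (ops := [:: _; _; _])).
rewrite /= /upd /= E1 E13 E14 -/v0.
apply: (wp_seq_mid (Q1 := fun r m' => [/\ cell_regs j S w r, m' = m,
  S = 0 \/ 0 < v0 -> x j < r 18 & cell_sound j S w (r 18)])).
  apply: wp_ifnz => /= D.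
    have /andP [/eqP D1 /eqP D2] : (1 - S * W.+1 == 0) && (v0 == 0).
      by rewrite -addn_eq0 D.
    split=> /=; [exact: Hregs|by []| |by rewrite D2].
    by case=> [S0|]; [rewrite S0 in D1|rewrite D2].
  apply: (wp_block (ops := [:: _; _])); rewrite /= /upd /= E10 addn0.
  split=> /=; [exact: Hregs|by []|by []|].
  apply: (cell_sound_init Hv0); have [|S_gt0] := posnP S; [by left|right].
  by rewrite lt0n; apply/eqP => v00; apply: D; rewrite v00; nia.
move=> {Hregs E1 E2 E3 E4 E5 E6 E7 E8 E9 E10 E11 E12 E13 E14 E15 E16 E17 r}.
move=> r _ [Hregs -> Hx Hs].
have := Hregs; case=> -[[[E1 E2 E3 E4 E5] [E6 E7 E8 E9]] E10 E11 E12].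
move=> E13 E14 E15 [E16 E17].
apply: wp_seq; apply: (wp_block (ops := [:: _; _; _; _])).
rewrite /= /upd /= E2 E7 E11 E14 !addn0.
apply: wp_seq; apply: (wp_while (I := scan_inv j S w v0 m)).
- split=> /=; [exact: Hregs|by []| |].
    (* The scan starts at k = s, where the remainder modulo 2 ^ s is S itself. *)
    by split=> //=; rewrite modn_small.
  split=> //= i le_si lt_is.
  by have := leq_trans lt_is le_si; rewrite ltnn.
- move=> k r' m' ltk Hinv; split; last exact: ball_body_spec.
  by case: Hinv => _ _ [-> _ _] _.
move=> {Hregs E1 E2 E3 E4 E5 E6 E7 E8 E9 E10 E11 E12 E13 E14 E15 E16 E17 Hx Hs r}.
move=> r _ [Hregs -> [-> _ _] [Hx Hs Hm]]; split=> //.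
have := Hregs; case=> -[[[E1 E2 E3 E4 E5] [E6 E7 E8 E9]] E10 E11 E12].
move=> E13 E14 E15 [E16 E17].
have Hstrong : cell_optimal j S w (r 18).
  apply: (cell_optimal_max Hv0 Hx Hs _ (fun i => Hm i isT)) => i lti bi lec.
  have := @tab (S - 2 ^ i) (w - c i j).
  rewrite pred_cell_lt ?expn_gt0 ?bit_le //; apply.
    exact: leq_ltn_trans (leq_subr _ _) ltS.
  exact: leq_ltn_trans (leq_subr _ _) ltw.
apply: (wp_block (ops := [:: _; _; _; _])).
rewrite /= /upd /= -/(upd _ _ _) E13 E16 E17 E1.
split; last 2 first.
- exact: layout_write (leq_addr _ _) lay.
- exact: table_write.
rewrite /upd; split=> //=; first by rewrite addn1 !addnS.
by split; [rewrite addn1|rewrite subn1 subnS].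
Qed.

Definition set_inv (j S : nat) : state_pred := fun r m =>
  [/\ bin_regs j r, r r_cell = base + S * W.+1, r r_set = S * W.+1 &
      r r_setctr = (2 ^ s - S) * W.+1] /\ (layout m /\ table j (S * W.+1) m).

Lemma set_body_spec j S r m :
  j < t -> S < 2 ^ s -> set_inv j S r m ->
  wp set_body r m (W.+1 * (s * 21 + 17) + 6) (set_inv j S.+1).
Proof.
move=> ltj ltS [[Hregs E13 E14 E15] [lay tab]].
have := Hregs; case=> -[[E1 E2 E3 E4 E5] [E6 E7 E8 E9]] E10 E11 E12.
have -> : W.+1 * (s * 21 + 17) + 6 = 3 + ((W.+1 * (s * 21 + 15).+2).+1 + 2) by lia.
apply: wp_seq; apply: (wp_block (ops := [:: _; _; _])).
rewrite /= /upd /= E4 addn0.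
apply: wp_seq; apply: (wp_while (I := fun k => cell_inv j S (W.+1 - k))).
- rewrite subnn; split=> /=; [|by []|by rewrite addn0].
  by split=> //=; rewrite addn0.
- move=> k r' m' ltk Hinv.
  have E : W.+1 - k = (W.+1 - k.+1).+1 by rewrite subnSK.
  split.
    by case: Hinv => -[_ _ _ _ [_ ->]] _ _; rewrite subKn.
  rewrite E; apply: cell_body_spec => //.
  by rewrite subSS ltnS leq_subr.
move=> {Hregs E1 E2 E3 E4 E5 E6 E7 E8 E9 E10 E11 E12 E13 E14 E15 lay tab m r}.
move=> r m [Hregs lay]; rewrite subn0 => tab.
have := Hregs; case=> -[[[E1 E2 E3 E4 E5] [E6 E7 E8 E9]] E10 E11 E12].
move=> E13 E14 E15 [E16 E17].
rewrite E17 subn0 subnn; split=> //.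
apply: (wp_block (ops := [:: _; _])); rewrite /= /upd /= E14 E15 E4.
split; last by rewrite mulSn addnC.
split=> /=; [by case: Hregs => Hb _ _ _ _; exact: Hb| | |].
    by rewrite E13 subn0 mulSn [W.+1 + _]addnC.
  by rewrite mulSn addnC.
by rewrite -(addn1 S) subnDA [RHS]mulnBl mul1n.
Qed.

(** The frontier 0 says that no cell is updated for bin j yet. The cell pointer is constrained only
    once a bin has been treated, for the final read. *)
Definition bin_inv (j : nat) : state_pred := fun r m =>
  [/\ consts r, r r_capptr = 3 + s + j, r r_binctr = t - j &
      0 < j -> r r_cell = base + 2 ^ s * W.+1] /\ (layout m /\ table j 0 m).

Lemma bin_body_spec j r m :
  j < t -> bin_inv j r m ->
  wp bin_body r m (2 ^ s * (W.+1 * (s * 21 + 17) + 8) + 8) (bin_inv j.+1).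
Proof.
move=> ltj [[Hregs E11 E12 _] [lay tab]].
have := Hregs; case=> -[E1 E2 E3 E4 E5] [E6 E7 E8 E9].
have -> : 2 ^ s * (W.+1 * (s * 21 + 17) + 8) + 8 =
  5 + ((2 ^ s * (W.+1 * (s * 21 + 17) + 6).+2).+1 + 2) by lia.
apply: wp_seq; apply: (wp_block (ops := [:: _; _; _; _; _])).
rewrite /= /upd /= E11 (layout_capacity lay ltj) E1 addn1 E6 E8 !addn0.
apply: wp_seq; apply: (wp_while (I := fun k => set_inv j (2 ^ s - k))).
- rewrite subnn; split; last by rewrite mul0n.
  by split=> //=; rewrite ?addn0 ?subn0.
- move=> k r' m' ltk Hinv; split.
    by case: Hinv => -[_ _ _ ->] _; rewrite subKn.
  rewrite -(subnSK ltk); apply: set_body_spec => //.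
  by rewrite -subn_gt0 subKn.
move=> {Hregs E1 E2 E3 E4 E5 E6 E7 E8 E9 E11 E12 lay tab m r}.
move=> r m; rewrite subn0 => -[[Hregs E13 E14 E15] [lay tab]].
have := Hregs; case=> -[[E1 E2 E3 E4 E5] [E6 E7 E8 E9]] E10 E11 E12.
split; first by rewrite E15 subnn.
apply: (wp_block (ops := [:: _; _])); rewrite /= /upd /= E11 E12 E1.
split; first by split=> //=; [rewrite addn1 addnS|rewrite subn1 subnS].
(* The frontier has passed every cell, so each optimal value for bin j becomes a feasibility flag
   for the next bin. *)
split=> // S w ltS ltw _; apply: cell_optimal_decides.
have := tab S w ltS ltw; rewrite ifT //.
have := leq_mul ltS (leqnn W.+1); rewrite mulSn; lia.
Qed.

Definition setup_regs (r : nat -> nat) : Prop :=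
  [/\ r r_out = 0, r r_one = 1, r r_s = s, r r_t = t & r r_width = W.+1 /\ r r_three = 3].

Lemma setup_spec : wp setup (fun=> 0) inp (s * 10 + 17) (bin_inv 0).
Proof.
have -> : s * 10 + 17 = 8 + ((s * 4).+1 + (6 + ((s * 6).+1 + 1))) by lia.
apply: wp_seq; apply: (wp_block (ops := [:: _; _; _; _; _; _; _; _])).
rewrite /= /upd /= inp0 inp1 inp2 addn1 addn0.
apply: wp_seq; apply: (wp_while (n := s) (T := 2) (I := fun k r m =>
  [/\ setup_regs r, r 7 = (s - k) * t, r 19 = k & m = inp])).
- by split=> //=; rewrite subnn.
- move=> k r m ltk [H E7 E19 ->]; have [E0 E1 E2 E3 [E4 E9]] := H.
  split; first by rewrite E19.
  apply: (wp_block (ops := [:: _; _])); rewrite /= /upd /= E7 E3 E19 E1.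
  split=> //=; last by rewrite subn1.
  by rewrite -(subnSK ltk) mulSn addnC.
move=> r _ [H E7 E19 ->]; have [E0 E1 E2 E3 [E4 E9]] := H.
split=> //; apply: wp_seq; apply: (wp_block (ops := [:: _; _; _; _; _; _])).
rewrite /= /upd /= E0 E2 E3 E4 E9 E7 subn0 !addn0 -/pow_base.
apply: wp_seq; apply: (wp_while (n := s) (T := 4) (I := fun k r m =>
  (* With k powers still to write, exactly the cells from [pow_base] up to [pow_base + (s - k)] have
     been overwritten. *)
  [/\ [/\ setup_regs r, r 5 = pow_base, r 7 = s * t & r 11 = 3 + s],
      [/\ r 19 = k, r 8 = 2 ^ (s - k) * W.+1 & r 6 = pow_base + (s - k)],
      forall a, (a < pow_base) || (pow_base + (s - k) <= a) -> m a = inp a &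
      forall i, i < s - k -> m (pow_base + i) = 2 ^ i * W.+1])).
- rewrite subnn; split=> /=; [|by split; rewrite /= ?mul1n ?addn0|by []|by []].
  by split=> //=; rewrite E7 subn0.
- move=> k r' m ltk [[H' E5' E7' E11'] [E19' E8' E6'] Hin Hpow].
  have [E0' E1' E2' E3' [E4' E9']] := H'.
  split; first by rewrite E19'.
  apply: (wp_block (ops := [:: _; _; _; _])).
  rewrite /= /upd /= E6' E8' E19' E1' -(subnSK ltk) addn1 addnn -mul2n mulnA.
  rewrite -expnS addnS subn1 /=; split=> //= [a Ha|i lti].
    rewrite ifN; first by apply: Hin; lia.
    by apply/eqP; lia.
  rewrite eqn_add2l; have [->//|neq] := eqVneq; apply: Hpow; lia.
move=> {H E0 E1 E2 E3 E4 E7 E9 E19 r} r m [[H E5 E7 E11] [E19 E8 E6]].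
have [E0 E1 E2 E3 [E4 E9]] := H.
rewrite subn0 in E6 E8 *; move=> Hin Hpow; split=> //.
apply: (wp_block (ops := [:: _])); rewrite /= /upd /= E3 E0 addn0.
split; first by split=> //=; rewrite ?addn0 ?subn0.
split; first by split=> // a lt_a; apply: Hin; rewrite lt_a.
move=> S w ltS ltw; rewrite ltn0 => S_gt0.
rewrite Hin; last by rewrite -/base leq_addr orbT.
(* The table area lies beyond the input, where memory reads 0. *)
rewrite inp_out; first exact: cell_decides0.
by rewrite -/pow_base /base; lia.
Qed.

Definition solver_time : nat :=
  s * 10 + 17 + ((t * (2 ^ s * (W.+1 * (s * 21 + 17) + 8) + 10)).+1 + 4).

Lemma solver_spec :
  wp solver (fun=> 0) inp solver_time (fun r _ =>
    exists2 v, cell_decides t (2 ^ s - 1) W v & r r_out = nat_of_bool (0 < v)).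
Proof.
apply: wp_seq_mid setup_spec _ => r m Hinv0.
have -> : t * (2 ^ s * (W.+1 * (s * 21 + 17) + 8) + 10) =
  t * (2 ^ s * (W.+1 * (s * 21 + 17) + 8) + 8).+2 by lia.
apply: wp_seq; apply: (wp_while (I := fun k => bin_inv (t - k))).
- by rewrite subnn.
- move=> k r' m' ltk Hinv; split.
    by case: Hinv => -[_ _ -> _] _; rewrite subKn.
  rewrite -(subnSK ltk); apply: bin_body_spec => //.
  by rewrite -subn_gt0 subKn.
move=> {Hinv0 r m} r m; rewrite subn0 => -[[Hregs _ E12 E13] [_ tab]].
have := Hregs; case=> -[E1 _ _ _ _] _.
split; first by rewrite E12 subnn.
apply: (wp_block (ops := [:: _; _; _; _])).
rewrite /= /upd /= E13 // E1.
have e_gt0 : 0 < 2 ^ s by rewrite expn_gt0.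
have := tab (2 ^ s - 1) W; rewrite ltn0 => /(_ _ (ltnSn _)).
have -> : (2 ^ s - 1) * W.+1 + W = 2 ^ s * W.+1 - 1 by nia.
rewrite addnBA ?muln_gt0 ?e_gt0 // => Hw.
(* There is at least one ball, so the full mask is nonzero and its cell is covered by the table
   invariant. *)
have e_gt1 : 1 < 2 ^ s by rewrite -{1}(expn0 2) ltn_exp2l.
eexists; first by apply: Hw; lia.
by case: (m _).
Qed.

End Correctness.

(** The time is linear in 2 ^ s * s * t * W, and the remaining factor s ^ 2 * W is at least 1. In
    the constants, 84 = 2 * 38 + 8, 94 = 84 + 10 and 126 = 94 + 10 + 22, where 10 * s and 22 come
    from the code outside the main loop. *)
Lemma solver_time_bound s t W : 0 < s -> 0 < t -> 0 < W ->
  solver_time s t W <= 126 * (2 ^ s * s ^ 3 * t * W ^ 2).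
Proof.
move=> s_gt0 t_gt0 W_gt0; rewrite /solver_time.
have : 0 < 2 ^ s by rewrite expn_gt0.
move: (2 ^ s) => e e_gt0.
have sW_gt0 : 0 < s * W by rewrite muln_gt0 s_gt0.
have esW_gt0 : 0 < e * (s * W) by rewrite muln_gt0 e_gt0.
have H1 : W.+1 * (s * 21 + 17) + 8 <= 84 * (s * W) by nia.
have H2 : e * (W.+1 * (s * 21 + 17) + 8) + 10 <= 94 * (e * (s * W)).
  by have := leq_mul (leqnn e) H1; lia.
have H3 := leq_mul (leqnn t) H2.
have H4 : s <= t * (e * (s * W)).
  by rewrite mulnA mulnCA leq_pmulr // !muln_gt0 t_gt0 e_gt0.
have H5 : t * (e * (s * W)) <= e * s ^ 3 * t * W ^ 2.
  rewrite (_ : t * _ = e * s * t * W); last by lia.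
  rewrite (_ : e * s ^ 3 * _ * _ = e * s * t * W * (s ^ 2 * W)); last first.
    by rewrite !expnS !expn0; lia.
  by rewrite leq_pmulr // muln_gt0 expn_gt0 s_gt0.
lia.
Qed.

(** * Instances and their encoding *)

Lemma nth_allpairs (A B C : Type) (x0 : A) (y0 : B) (z0 : C) (f : A -> B -> C)
    (xs : seq A) (ys : seq B) i j :
  i < size xs -> j < size ys ->
  nth z0 [seq f a b | a <- xs, b <- ys] (i * size ys + j)
  = f (nth x0 xs i) (nth y0 ys j).
Proof.
elim: xs i => [|a xs IH] [|i] //= lti ltj; rewrite nth_cat size_map.
  by rewrite ltj (nth_map y0).
rewrite mulSn -addnA ifF; last by lia.
by rewrite addKn IH.
Qed.

Lemma nth_cat_size (T : Type) (z : T) (s1 s2 : seq T) n i :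
  size s1 = n -> nth z (s1 ++ s2) (n + i) = nth z s2 i.
Proof. by move=> <-; rewrite nth_cat ltnNge leq_addr addKn. Qed.

Section Encoding.

Variable X : balls_in_bins.
Local Notation s := (nballs X).
Local Notation t := (nbins X).
Local Notation inp := (nth 0 (encode_instance X)).

Lemma size_encode : size (encode_instance X) = 3 + s + t + s * t.
Proof.
rewrite /encode_instance !size_cat size_allpairs (size_map (@size_of X)).
by rewrite (size_map (@capacity X)) !size_enum_ord /= !addnA.
Qed.

Lemma size_map_ord n (f : 'I_n -> nat) : size [seq f i | i <- enum 'I_n] = n.
Proof. by rewrite size_map size_enum_ord. Qed.

Lemma encode_size (i : 'I_s) : inp (3 + i) = size_of i.
Proof.
rewrite /encode_instance nth_cat_size // nth_cat size_map_ord ltn_ord.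
by rewrite (nth_map i) ?size_enum_ord // nth_ord_enum.
Qed.

Lemma encode_capacity (j : 'I_t) : inp (3 + s + j) = capacity j.
Proof.
rewrite /encode_instance -addnA nth_cat_size // nth_cat_size ?size_map_ord //.
rewrite nth_cat size_map_ord ltn_ord.
by rewrite (nth_map j) ?size_enum_ord // nth_ord_enum.
Qed.

Lemma encode_cost (i : 'I_s) (j : 'I_t) :
  inp (3 + s + t + (i * t + j)) = cost i j.
Proof.
rewrite /encode_instance -2!addnA nth_cat_size // !nth_cat_size ?size_map_ord //.
have := nth_allpairs i j 0 (@cost X) (xs := enum 'I_s) (ys := enum 'I_t).
by rewrite !size_enum_ord => ->; rewrite ?nth_ord_enum.
Qed.

(** The mask [2 ^ s - 1] contains every ball, so the restricted sums become the sums over all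
    balls. *)
Lemma feasible_assignment (beta : {ffun 'I_s -> 'I_t}) (f : nat -> nat) :
  (forall i : 'I_s, f i = beta i :> nat) ->
  feasible s (fun i => inp (3 + i)) (fun j => inp (3 + s + j))
    (fun i j => inp (3 + s + t + (i * t + j))) t (2 ^ s - 1) (budget X) f
  <-> is_assignment beta && (assignment_cost beta <= budget X).
Proof.
move=> fE.
have loadE (j : 'I_t) : load s (fun i => inp (3 + i)) (2 ^ s - 1) f j =
    \sum_(i | beta i == j) size_of i.
  rewrite /load big_mkord; apply: eq_big => [i|i _]; last exact: encode_size.
  by rewrite bit_full //= fE.
have costE : total_cost s (fun i j => inp (3 + s + t + (i * t + j)))
    (2 ^ s - 1) f = assignment_cost beta.
  rewrite /total_cost big_mkord; apply: eq_big => [i|i _]; first exact: bit_full.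
  by rewrite fE encode_cost.
split=> [[_ Hl Hc]|/andP [/forallP Ha Hc]].
  rewrite -costE Hc andbT; apply/forallP => j.
  by rewrite -loadE -encode_capacity; apply: Hl.
split; last by rewrite costE.
  by move=> i lti _; rewrite (fE (Ordinal lti)) ltn_ord.
by move=> k ltk; have := Ha (Ordinal ltk); rewrite -loadE -encode_capacity.
Qed.

Lemma cheap_assignmentP :
  reflect (exists f, feasible s (fun i => inp (3 + i)) (fun j => inp (3 + s + j))
    (fun i j => inp (3 + s + t + (i * t + j))) t (2 ^ s - 1) (budget X) f)
  (has_cheap_assignment X).
Proof.
apply: (iffP existsP) => [[beta Hbeta]|[f Hf]].
  (* The value 0 beyond the last ball is a harmless default. *)
  exists (fun i => if insub i is Some o then beta o : nat else 0).
  by apply/(feasible_assignment (beta := beta)) => // i; rewrite valK.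
pose j0 := Ordinal (nbins_gt0 X).
(* Feasibility puts every [f i] below t, so the default bin [j0] is never taken. *)
exists [ffun i : 'I_s => insubd j0 (f i)].
apply/(feasible_assignment (f := f)) => // i; rewrite ffunE val_insubd.
by case: Hf => /(_ i (ltn_ord i)) /(_ (bit_full (ltn_ord i))) ->.
Qed.

End Encoding.

Theorem mainTheorem7 :
  decidable_in_time_O encode_instance has_cheap_assignment
    (fun X : balls_in_bins =>
       2 ^ nballs X * nballs X ^ 3 * nbins X * budget X ^ 2).
Proof.
exists (compile 0 solver), 126 => X.
have inp_out a : 3 + nballs X + nbins X + nballs X * nbins X <= a ->
    nth 0 (encode_instance X) a = 0.
  by move=> le_a; rewrite nth_default // size_encode.
have code : code_at (compile 0 solver) 0 (compile 0 solver) by [].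
have [n [r [m [le_n run [v Hv E]]]]] :=
  solver_spec (nballs_gt0 X) (nbins_gt0 X) (erefl (nballs X))
    (erefl (nbins X)) (erefl (budget X)) inp_out code.
exists n; rewrite /init run; split.
- apply: leq_trans le_n _; apply: solver_time_bound.
  + exact: nballs_gt0.
  + exact: nbins_gt0.
  + exact: budget_gt0.
(* The run ends just past the last instruction, where [fetch] returns its default [Halt]. *)
- by rewrite /halted /fetch nth_default // size_compile.
- rewrite /= E; congr nat_of_bool; apply/idP/cheap_assignmentP => /Hv //.
Qed.
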